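(* Let $\mathbb{F}$ be a finite field with $q$ elements and $n\ge 2$ an integer. Let $N=\frac{q^n-1}{q-1}$ and let $v_1,\dots,v_N$ be an enumeration of the $1$-dimensional subspaces of $\mathbb{F}^n$. Let $K$ be a field of characteristic zero and $F=\sum X_{i_1}\cdots X_{i_n}\in K[X_1,\dots,X_N]$, summed over all $1\le i_1<\cdots<i_n\le N$ such that $v_{i_1},\dots,v_{i_n}$ form a basis of $\mathbb{F}^n$. Let $H(F)=\left(\frac{\partial^2F}{\partial X_i\partial X_j}\right)_{1\le i,j\le N}$ be its Hessian matrix. Let $A=(a_{ij})$ be the $N\times N$ matrix with $a_{ij}=1$ if $v_i\in v_j^\perp$ and $0$ otherwise, where $v^\perp=\{w:\sum_k v_kw_k=0\}$, and let $B=(1-a_{ij})$. Then $H(F)\big|_{X_1=\cdots=X_N=1}=\frac{t_{n-1,1,q}}{(n-2)!}\,AB$, where $t_{n-1,1,q}=q^{(n-1)(n-2)/2}\prod_{k=1}^{n-2}\frac{q^k-1}{q-1}$. *)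

(* Defs.v *)
From mathcomp Require Import all_boot all_order all_algebra.
From mathcomp Require Export mpoly.

Set Implicit Arguments.
Unset Strict Implicit.
Unset Printing Implicit Defensive.

Import GRing.Theory.
Local Open Scope ring_scope.

Definition enumerates_lines (F : fieldType) (n N : nat)
    (L : 'I_N -> {vspace 'rV[F]_n}) : Prop :=
  injective L /\
  (forall U : {vspace 'rV[F]_n}, \dim U = 1%N <-> exists i, L i = U).

Definition perp (F : finFieldType) (n : nat) (w : 'rV[F]_n) : {set 'rV[F]_n} :=
  [set u : 'rV[F]_n | \sum_(k < n) w 0 k * u 0 k == 0].

(* The index tuples (i_1, ..., i_n) are those with i_1 < ... < i_n. *)
Definition basis_poly (F : fieldType) (K : fieldType) (n N : nat)
    (v : 'I_N -> 'rV[F]_n) : {mpoly K[N]} :=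
  \sum_(t : n.-tuple 'I_N |
        sorted ltn [seq val i | i <- t] && basis_of fullv [seq v i | i <- t])
    \prod_(i <- t) 'X_i.

Definition hessian (K : fieldType) (N : nat) (p : {mpoly K[N]}) :
    'M[{mpoly K[N]}]_N :=
  \matrix_(i, j) mderiv i (mderiv j p).

Definition perp_mx (F : finFieldType) (K : fieldType) (n N : nat)
    (v : 'I_N -> 'rV[F]_n) : 'M[K]_N :=
  \matrix_(i, j) (v i \in perp (v j))%:R.

Definition nonperp_mx (F : finFieldType) (K : fieldType) (n N : nat)
    (v : 'I_N -> 'rV[F]_n) : 'M[K]_N :=
  \matrix_(i, j) (1 - perp_mx K v i j).

(* The number t_{n-1,1,q}, as an element of K; the division in the exponent is
   exact, and q%:R - 1 is nonzero when K has characteristic 0 and q > 1. *)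
Definition tnum (K : fieldType) (n q : nat) : K :=
  q%:R ^+ (((n - 1) * (n - 2)) %/ 2) *
  \prod_(1 <= k < n - 1) ((q%:R ^+ k - 1) / (q%:R - 1)).

(* Main.v *)
Require Import Defs.
From mathcomp Require Import all_boot all_order all_algebra.
From mathcomp Require Import finfield mxabelem.
Set Implicit Arguments.
Unset Strict Implicit.

Import GRing.Theory.
Local Open Scope ring_scope.

(** For i = j both entries vanish. For i <> j, the (i, j) entry of the Hessian
    at (1, ..., 1) is the number of (n-2)-element sets of lines completing
    {v_i, v_j} to a basis. Choosing these lines one at a time, the l-th one
    outside a subspace of dimension 2 + l, gives
      prod_(l < n-2) (q^n - q^(2+l)) / (q-1) = t_(n-1,1,q) * q^(n-2)
    ordered choices. On the other side, (AB)_ij is the number of lines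
    orthogonal to v_i and not to v_j, that is
      (q^(n-1) - q^(n-2)) / (q-1) = q^(n-2). *)

Lemma line_gen_neq0 (F : fieldType) (n N : nat)
    (L : 'I_N -> {vspace 'rV[F]_n}) (v : 'I_N -> 'rV[F]_n) :
  enumerates_lines L -> (forall i, L i = <[v i]>%VS) -> forall i, v i != 0.
Proof.
move=> [_ hL] hv i; have /hL : exists j, L j = L i by exists i.
by rewrite hv dim_vline; case: eqP.
Qed.

Lemma line_gen_inj (F : fieldType) (n N : nat)
    (L : 'I_N -> {vspace 'rV[F]_n}) (v : 'I_N -> 'rV[F]_n) :
  enumerates_lines L -> (forall i, L i = <[v i]>%VS) ->
  forall i j, v i \in <[v j]>%VS -> i = j.
Proof.
move=> hL hv i j vij; have [Linj _] := hL; apply: Linj; apply/eqP.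
by rewrite eqEdim !hv -memvE vij !dim_vline !(line_gen_neq0 hL hv).
Qed.

Lemma line_gen_surj (F : fieldType) (n N : nat)
    (L : 'I_N -> {vspace 'rV[F]_n}) (v : 'I_N -> 'rV[F]_n) :
  enumerates_lines L -> (forall i, L i = <[v i]>%VS) ->
  forall w, w != 0 -> exists c i, w = c *: v i.
Proof.
move=> [_ hL] hv w w0; have /hL[i Li] : \dim <[w]> = 1%N by rewrite dim_vline w0.
have : w \in <[v i]>%VS by rewrite -hv Li memv_line.
by case/vlineP=> c ->; exists c, i.
Qed.

(** Every nonzero vector is [c *: v i] for exactly one nonzero scalar [c] and one index [i]. So
    pairs of a nonzero scalar and a line in [P] correspond bijectively to the vectors in [P];
    scaling invariance makes [P] a property of lines. *)
Lemma card_lines (F : finFieldType) (n N : nat)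
    (L : 'I_N -> {vspace 'rV[F]_n}) (v : 'I_N -> 'rV[F]_n)
    (P : pred 'rV[F]_n) :
  enumerates_lines L -> (forall i, L i = <[v i]>%VS) -> ~~ P 0 ->
  (forall c w, c != 0 -> P (c *: w) = P w) ->
  ((#|F| - 1) * #|[set i | P (v i)]|)%N = #|[set w | P w]|.
Proof.
move=> hL hv P0 PZ; pose f (x : F * 'I_N) := x.1 *: v x.2.
have /card_in_imset cf : {in setX [set~ 0] [set i | P (v i)] &, injective f}.
  move=> [c i] [d j]; rewrite !inE /f /= => /andP[c0 _] /andP[d0 _] e.
  have ij : i = j.
    apply: (line_gen_inj hL hv); apply/vlineP; exists (c^-1 * d).
    by rewrite -scalerA -e scalerA mulVf ?scale1r.
  subst j; congr pair; apply/eqP; rewrite -subr_eq0.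
  have /eqP := e; rewrite -subr_eq0 -scalerBl scaler_eq0.
  by rewrite (negbTE (line_gen_neq0 hL hv i)) orbF.
rewrite subn1 -(cardC1 (0 : F)).
have -> : #|predC1 (0 : F)| = #|[set~ (0 : F)]| by apply: eq_card => x; rewrite !inE.
rewrite -cardsX -cf; apply: eq_card => w; rewrite inE.
apply/imsetP/idP => [[[c i]] | Pw].
  by rewrite !inE /= => /andP[c0 Pi] ->; rewrite PZ.
have w0 : w != 0 by apply: contraNneq P0 => <-.
have [c [i wE]] := line_gen_surj hL hv w0.
have c0 : c != 0 by apply: contraNneq w0 => c0; rewrite wE c0 scale0r.
by exists (c, i); rewrite // !inE c0 -(PZ c) // -wE.
Qed.

Lemma card_lines_notin (F : finFieldType) (n N : nat)
    (L : 'I_N -> {vspace 'rV[F]_n}) (v : 'I_N -> 'rV[F]_n)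
    (U : {vspace 'rV[F]_n}) :
  enumerates_lines L -> (forall i, L i = <[v i]>%VS) ->
  ((#|F| - 1) * #|[set i | v i \notin U]|)%N = (#|F| ^ n - #|F| ^ \dim U)%N.
Proof.
move=> hL hv; rewrite (card_lines (P := fun w => w \notin U) hL hv) ?mem0v //.
  have -> : (#|F| ^ n)%N = #|{: 'rV[F]_n}| by rewrite card_mx mul1n.
  rewrite -(@card_vspace F 'rV[F]_n _ U) -(cardC [in U]) addKn.
  by apply: eq_card => w; rewrite !inE.
by move=> c w c0; rewrite rpredZeq (negbTE c0).
Qed.

(** Induction on [m]: the new line goes in front and must avoid the span of the family built so far,
    whose dimension is its size because it is free. Each choice brings one factor [#|F| - 1], the
    number of generators of a line. *)
Lemma card_free_extensions (F : finFieldType) (n N : nat)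
    (L : 'I_N -> {vspace 'rV[F]_n}) (v : 'I_N -> 'rV[F]_n)
    (e : seq 'rV[F]_n) (m : nat) :
  enumerates_lines L -> (forall i, L i = <[v i]>%VS) -> free e ->
  ((#|F| - 1) ^ m * #|[set s : m.-tuple 'I_N | free ([seq v i | i <- s] ++ e)]|)%N
    = (\prod_(l < m) (#|F| ^ n - #|F| ^ (size e + l)))%N.
Proof.
move=> hL hv fe; elim: m => [|m IH].
  rewrite big_ord0 mul1n (_ : [set _ | _] = setT) ?cardsT ?card_tuple //.
  by apply/setP => s; rewrite !inE (tuple0 s).
rewrite big_ord_recr /= -IH.
pose S := [set s : m.-tuple 'I_N | free ([seq v i | i <- s] ++ e)].
have -> : #|[set s : m.+1.-tuple 'I_N | free ([seq v i | i <- s] ++ e)]|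
    = (\sum_(s in S) #|[set i | v i \notin <<[seq v i | i <- s] ++ e>>%VS]|)%N.
  rewrite -sum1_card (reindex (fun x : m.-tuple 'I_N * 'I_N => [tuple of x.2 :: x.1])) /=.
    under [RHS]eq_bigr do rewrite -sum1_card.
    rewrite pair_big_dep /=; apply: eq_bigl => -[s i].
    by rewrite !inE /= free_cons andbC.
  exists (fun s : m.+1.-tuple 'I_N => ([tuple of behead s], thead s)) => [[s x]|s] _ /=.
    by congr pair; apply: val_inj.
  by rewrite [RHS]tuple_eta; apply: val_inj.
rewrite expnSr -mulnA big_distrr /= -mulnA; congr (_ * _)%N.
rewrite -sum_nat_const; apply: eq_bigr => s.
rewrite inE => fs; rewrite (card_lines_notin _ hL hv); congr (_ - _ ^ _)%N.
by move: fs; rewrite /free => /eqP ->; rewrite size_cat size_map size_tuple addnC.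
Qed.

(** The vectors orthogonal to [u1] form the kernel of one column, of rank 1. Those orthogonal to
    both form the kernel of two independent columns, of rank 2, and are subtracted. *)
Lemma card_perp_nonperp (F : finFieldType) (n : nat) (u1 u2 : 'rV[F]_n) :
  u1 != 0 -> u2 != 0 -> u1 \notin <[u2]>%VS ->
  #|[set w | (u1 \in perp w) && (w \notin perp u2)]|
    = (#|F| ^ (n - 1) - #|F| ^ (n - 2))%N.
Proof.
move=> u10 u20 u12.
have kerE m (M : 'M[F]_(n, m)) :
    #|[set w : 'rV[F]_n | w *m M == 0]| = (#|F| ^ (n - \rank M))%N.
  rewrite -mxrank_ker -card_rowg; apply: eq_card => w.
  by rewrite inE mem_rowg; apply/eqP/sub_kermxP.
have r1 : \rank u1^T = 1%N by rewrite mxrank_tr rank_rV u10.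
(* The intersection lies in the line of [u1]; if it had rank 1 it would be that line, making [u1] a
   multiple of [u2]. *)
have cap0 : (u1 :&: u2)%MS = 0.
  apply/eqP; rewrite -mxrank_eq0 -leqn0 -ltnS.
  have := mxrank_leqif_sup (capmxSl u1 u2); rewrite rank_rV u10 => -[le1 eq1].
  rewrite ltn_neqAle le1 andbT eq1 sub_capmx submx_refl /=.
  by apply: contra u12 => /sub_rVP[c ->]; apply/vlineP; exists c.
have r2 : \rank (row_mx u1^T u2^T) = 2%N.
  by rewrite -tr_col_mx mxrank_tr -addsmxE mxrank_disjoint_sum // !rank_rV u10 u20.
have dotE (u w : 'rV[F]_n) : (w *m u^T == 0) = (\sum_(k < n) w 0 k * u 0 k == 0).
  have -> : \sum_(k < n) w 0 k * u 0 k = (w *m u^T) 0 0.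
    by rewrite mxE; apply: eq_bigr => k _; rewrite mxE.
  apply/eqP/eqP => [->|e]; first by rewrite mxE.
  by apply/matrixP=> i j; rewrite !ord1 e mxE.
have := kerE _ u1^T; rewrite r1 => <-.
have := kerE _ (row_mx u1^T u2^T); rewrite r2 => <-.
rewrite -(cardsID [set w : 'rV[F]_n | w *m u2^T == 0] [set w : 'rV[F]_n | w *m u1^T == 0]).
have -> : [set w : 'rV[F]_n | w *m row_mx u1^T u2^T == 0] =
    [set w : 'rV[F]_n | w *m u1^T == 0] :&: [set w : 'rV[F]_n | w *m u2^T == 0].
  by apply/setP => w; rewrite !inE mul_mx_row row_mx_eq0.
rewrite addKn; apply: eq_card => w; rewrite !inE !dotE andbC.
by congr (~~ (_ == 0) && _); apply: eq_bigr => k _; rewrite mulrC.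
Qed.

(** Without repetitions in [t] the monomial is squarefree, so a repeated derivative kills it, and
    two distinct ones leave a monomial with coefficient 1 exactly when both variables occur. *)
Lemma hessian_monomial (K : fieldType) (N : nat) (t : seq 'I_N) (i j : 'I_N) :
  uniq t ->
  (mderiv i (mderiv j (\prod_(k <- t) 'X_k))).@[fun=> (1 : K)]
    = [&& i != j, i \in t & j \in t]%:R.
Proof.
move=> ut; have mev1 (m : 'X_{1.. N}) : 'X_[m].@[fun=> (1 : K)] = 1.
  by rewrite mevalX big1 // => k _; rewrite expr1n.
rewrite mprodXE mderivX linearZ /= mderivX !mevalZ mev1.
have mE k : (\sum_(l <- t) U_(l))%MM k = (k \in t) :> nat.
  rewrite mnm_sumE -(count_uniq_mem _ ut) -sum1_count [RHS]big_mkcond /=.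
  by apply: eq_bigr => l _; rewrite mnm1E; case: eqP.
(* The second coefficient is the exponent of [i] after one [j] is removed; the subtraction is
   truncated, so it is 0 when [i = j], whether or not [i] is in [t]. *)
rewrite mnmBE !mE mnm1E mulr1 eq_sym -natrM.
by case: eqP => [<-|_]; case: (_ \in t); case: (_ \in t).
Qed.

(** Sorting [[:: i, j & s]] forgets the order of [s]. Each increasing tuple containing [i] and [j]
    is reached from the [m!] orderings of its other entries, which are distinct. *)
Lemma card_sorted_tuples (N m : nat) (i j : 'I_N) (Q : pred (seq 'I_N)) :
  i != j ->
  (forall s t, perm_eq s t -> Q s = Q t) -> (forall s, Q s -> uniq s) ->
  (m`! * #|[set t : m.+2.-tuple 'I_N |
      [&& sorted ltn [seq val k | k <- t], Q t, i \in t & j \in t]]|)%N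
    = #|[set s : m.-tuple 'I_N | Q [:: i, j & s]]|.
Proof.
move=> ij Qperm Quniq; pose leI := relpre (val : 'I_N -> nat) leq.
have leI_tr : transitive leI by move=> x y z; apply: leq_trans.
have leI_anti : antisymmetric leI by move=> x y /anti_leq/val_inj.
have leI_tot : total leI by move=> x y; apply: leq_total.
have sortedE (t : seq 'I_N) : sorted ltn [seq val k | k <- t] = uniq t && sorted leI t.
  by rewrite ltn_sorted_uniq_leq (map_inj_uniq val_inj) sorted_map.
set T := [set t | _]; set S := [set s | _].
pose h (s : m.-tuple 'I_N) := [tuple of sort leI [:: i, j & s]].
(* As [leI] is a total order, a sorted sequence is determined by its multiset of entries; this
   describes the fibres of [h]. *)
have hP (s : m.-tuple 'I_N) (t : seq 'I_N) : sorted leI t ->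
    (tval (h s) == t) = perm_eq [:: i, j & s] t.
  move=> st; apply/eqP/idP => [<-|p].
    by rewrite perm_sym perm_sort.
  by rewrite /= -(sorted_sort leI_tr st); apply/(perm_sortP leI_tot leI_tr leI_anti).
rewrite -[RHS]sum1_card (partition_big h [in T]) /=; last first.
  move=> s; rewrite !inE sortedE sort_sorted // sort_uniq !mem_sort.
  rewrite !inE !eqxx orbT !andbT.
  move=> Qs; rewrite (Quniq _ Qs) andTb -(Qperm [:: i, j & s]) //.
  by rewrite perm_sym perm_sort.
rewrite mulnC -sum_nat_const; apply: eq_bigr => t.
rewrite inE sortedE => /and4P[/andP[ut st] Qt it jt].
(* The fibre of [h] over [t] consists of the permutations of [r]. *)
pose r := [seq k <- t | k \notin [:: i; j]].
have tr : perm_eq [:: i, j & r] t.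
  apply: uniq_perm => //.
    rewrite /r /= filter_uniq // !inE !mem_filter !inE !eqxx orbT.
    by rewrite (negbTE ij).
  move=> k; rewrite !inE /r mem_filter !inE negb_or.
  by case: eqVneq => [->|_]; [rewrite it | case: eqVneq => [->|_]; rewrite ?jt].
have sr : size r = m by have := perm_size tr; rewrite size_tuple => -[].
have ur : uniq r by rewrite filter_uniq.
have <- : size (permutations r) = m`! by rewrite size_permutations ?sr.
rewrite sum1dep_card cardE -(size_map val).
apply: perm_size; apply: uniq_perm.
- by rewrite permutations_uniq.
- by rewrite (map_inj_uniq val_inj) enum_uniq.
move=> s; rewrite mem_permutations; apply/idP/mapP => [p | [u]].
  have su : size s == m by rewrite (perm_size p) sr.
  have pt : perm_eq [:: i, j & s] t by apply: perm_trans tr; rewrite !perm_cons.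
  exists (Tuple su) => //; rewrite mem_enum !inE -val_eqE hP // pt /=.
  by rewrite (Qperm _ _ pt) Qt.
rewrite mem_enum !inE -val_eqE hP // => /andP[_ pt] ->.
by rewrite -(perm_cons j) -(perm_cons i) (permPl pt) perm_sym.
Qed.

Lemma perp_sym (F : finFieldType) (n : nat) (u w : 'rV[F]_n) :
  (u \in perp w) = (w \in perp u).
Proof. by rewrite !inE; congr (_ == 0); apply: eq_bigr => k _; rewrite mulrC. Qed.

(** Each factor splits as [q ^ (2 + l) * (q ^ (m - l) - 1)]; the powers of [q] supply the exponent
    in [tnum] and the extra [q ^ m]. *)
Lemma tnum_prod (K : fieldType) (m q : nat) :
  (q%:R - 1 != 0 :> K) -> (0 < q)%N ->
  (\prod_(l < m) (q ^ m.+2 - q ^ (2 + l)))%N%:R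
    = tnum K m.+2 q * q%:R ^+ m * (q%:R - 1) ^+ m.
Proof.
move=> q1 q0.
(* The quotient is the binomial coefficient of [m.+1] over 2, that is, the sum of the integers up to
   [m]. *)
have expoE : (\sum_(l < m) (2 + l) = (m.+2 - 1) * (m.+2 - 2) %/ 2 + m)%N.
  rewrite subn1 subn2 divn2 /= -bin2 big_split /= sum_nat_const card_ord.
  by rewrite -bin2_sum big_nat_recr //= big_mkord muln2 -addnn addnC addnA.
have -> : (\prod_(l < m) (q ^ m.+2 - q ^ (2 + l)))%N%:R
    = \prod_(l < m) (q%:R ^+ (2 + l) * (q%:R ^+ (m - l) - 1)) :> K.
  rewrite natr_prod; apply: eq_bigr => l _.
  have lm : (2 + l <= m.+2)%N by rewrite !ltnS ltnW.
  rewrite natrB ?leq_pexp2l // !natrX mulrBr mulr1 -exprD; congr (_ ^+ _ - _).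
  by rewrite -addnA subnKC // ltnW.
rewrite big_split /= prodrXr expoE exprD /tnum -!mulrA; congr (_ * _).
rewrite mulrCA; congr (_ * _).
(* The [m] denominators of [tnum] cancel [(q - 1) ^ m], and reversing the index turns the exponents
   [m - l] into [1, ..., m]. *)
rewrite big_add1 /= big_mkord prodf_div prodr_const card_ord.
rewrite divfK ?expf_neq0 // (reindex_inj rev_ord_inj) /=.
by apply: eq_bigr => l _; rewrite subKn.
Qed.

Theorem theorem4p11 (F : finFieldType) (q : nat) (hq : #|F| = q)
    (n : nat) (hn : (2 <= n)%N)
    (N : nat) (hN : N = ((q ^ n - 1) %/ (q - 1))%N)
    (L : 'I_N -> {vspace 'rV[F]_n}) (hL : enumerates_lines L)
    (v : 'I_N -> 'rV[F]_n) (hv : forall i, L i = <[v i]>%VS)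
    (K : fieldType) (hK : [pchar K] =i pred0) :
  map_mx (meval (fun _ => 1)) (hessian (basis_poly K v)) =
  (tnum K n q / ((n - 2)`!)%:R) *: (perp_mx K v *m nonperp_mx K v).
Proof.
have natK k : (k%:R == 0 :> K) = (k == 0%N) by move/pcharf0P: hK => ->.
have q_gt1 : (1 < q)%N by rewrite -hq (cardD1 0) (cardD1 1) !inE oner_neq0.
have q1K : q%:R - 1 = (q - 1)%:R :> K by rewrite natrB // ltnW.
have q1n0 : q%:R - 1 != 0 :> K by rewrite q1K natK subn_eq0 -ltnNge.
case: n hn hN L hL v hv => [|[|m]] // _ _ L hL v hv.
apply/matrixP => i j; rewrite !mxE.
pose T := [set t : m.+2.-tuple 'I_N | [&& sorted ltn [seq val k | k <- t],
  basis_of fullv [seq v k | k <- t], i \in t & j \in t]].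
have -> : (mderiv i (mderiv j (basis_poly K v))).@[fun=> 1] = ((i != j) * #|T|)%:R.
  rewrite (raddf_sum (mderiv j)) (raddf_sum (mderiv i)) raddf_sum /=.
  rewrite natrM -sum1_card natr_sum mulr_sumr.
  rewrite [LHS]big_mkcond [RHS]big_mkcond; apply: eq_bigr => t _.
  rewrite inE andbA; case: ifP => [/andP[st _] /=|//].
  rewrite hessian_monomial; last first.
    by move: st; rewrite ltn_sorted_uniq_leq (map_inj_uniq val_inj) => /andP[].
  by case: (i != j); case: (i \in t); case: (j \in t); rewrite /= ?mulr1 ?mulr0.
have -> : \sum_k perp_mx K v i k * nonperp_mx K v k j =
    #|[set k | (v i \in perp (v k)) && (v k \notin perp (v j))]|%:R.
  rewrite -sum1_card natr_sum [RHS]big_mkcond; apply: eq_bigr => k _.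
  rewrite !mxE inE.
  by case: (v i \in _); case: (v k \in _);
    rewrite /= ?subrr ?subr0 ?mulr1 ?mul0r ?mulr0.
have [-> | ij] := eqVneq i j.
  rewrite mul0n (_ : [set k | _] = set0) ?cards0 ?mulr0 //.
  by apply/setP => k; rewrite in_set in_set0 perp_sym andbN.
have vij : v i \notin <[v j]>%VS by apply: contra ij => /(line_gen_inj hL hv) ->.
have v0 := line_gen_neq0 hL hv.
(* After multiplication by [q - 1] this counts vectors: there are [q ^ m.+1 - q ^ m] of them. The
   zero vector is excluded, being orthogonal to [v j]. *)
have -> : #|[set k | (v i \in perp (v k)) && (v k \notin perp (v j))]|%:R = q%:R ^+ m :> K.
  apply: (mulfI q1n0); rewrite q1K -natrM -hq.
  rewrite (card_lines (P := fun w => (v i \in perp w) && (w \notin perp (v j))) hL hv).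
  - rewrite card_perp_nonperp // subn1 subn2 /= expnS -{2}[(_ ^ m)%N]mul1n -mulnBl.
    by rewrite natrM natrX.
  - rewrite !inE negb_and negbK [X in _ || (X == 0)]big1 ?eqxx ?orbT //.
    by move=> k _; rewrite mxE mulr0.
  move=> c w c0; rewrite perp_sym [in RHS]perp_sym !inE.
  have dotZ u : \sum_k u 0 k * (c *: w) 0 k = c * \sum_k u 0 k * w 0 k.
    by rewrite mulr_sumr; apply: eq_bigr => k _; rewrite mxE mulrCA.
  by rewrite !dotZ !mulf_eq0 (negbTE c0).
(* For [m.+2] vectors in dimension [m.+2], being free is the same as being a basis; freeness is also
   visibly invariant under permutation. *)
pose Q (s : seq 'I_N) := free [seq v k | k <- s].
have Qperm s t : perm_eq s t -> Q s = Q t by move=> p; apply/perm_free/perm_map.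
have Quniq s : Q s -> uniq s by move/free_uniq/map_uniq.
have cT := card_sorted_tuples m ij Qperm Quniq.
have fe : free [:: v i; v j].
  by rewrite free_cons span_seq1 vij /free span_seq1 dim_vline v0.
have cS := card_free_extensions m hL hv fe.
have eT : T = [set t : m.+2.-tuple 'I_N |
    [&& sorted ltn [seq val k | k <- t], Q t, i \in t & j \in t]].
  apply/setP => t; rewrite !inE /Q basisEfree subvf dimvf dim_matrix.
  by rewrite size_map size_tuple mul1r leqnn !andbT.
have eS : [set s : m.-tuple 'I_N | Q [:: i, j & s]]
    = [set s : m.-tuple 'I_N | free ([seq v k | k <- s] ++ [:: v i; v j])].
  by apply/setP => s; rewrite !inE; apply/perm_free; rewrite perm_sym perm_catC.
rewrite -eS -cT -eT hq /= in cS.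
have := congr1 (fun k => k%:R : K) cS.
rewrite (tnum_prod _ q1n0) ?(ltnW q_gt1) // !natrM natrX -q1K mulrC.
(* Cancelling [(q - 1) ^ m] leaves [m! * #|T|] equal to [tnum] times [q ^ m]; dividing by [m!] is
   possible in characteristic zero. *)
move/(mulIf (expf_neq0 m q1n0)) => e.
have f0 : (m`!)%:R != 0 :> K by rewrite natK -lt0n fact_gt0.
rewrite subn2 mul1r; apply: (mulfI f0); rewrite e /=.
by rewrite mulrA [_ * (_ / _)]mulrC divfK.
Qed.
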